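(* Let $R$ be an arithmetical ring and let $P\in\mathrm{Max}\ R\cup(\mathrm{Spec}\ R\setminus\mathrm{Min}\ R)$, i.e. $P$ is a prime ideal of $R$ which is maximal or is not a minimal prime. If $P^n$ is finitely generated for some integer $n>0$, then $P$ is finitely generated.
   Context: All rings are commutative with identity. A ring is a chain ring if its lattice of ideals is totally ordered by inclusion. A ring $R$ is arithmetical if the localization $R_M$ is a chain ring for each maximal ideal $M$ of $R$. $\mathrm{Spec}\ R$, $\mathrm{Max}\ R$, $\mathrm{Min}\ R$ denote the sets of prime ideals, maximal ideals and minimal prime ideals of $R$, respectively. *)

(* Defs.v *)
From HB Require Import structures.
From mathcomp Require Import all_boot all_algebra ring.
From mathcomp Require Import boolp classical_sets.

Set Implicit Arguments.
Unset Strict Implicit.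
Unset Printing Implicit Defensive.

Import GRing.Theory.
Local Open Scope quotient_scope.
Local Open Scope classical_set_scope.
Local Open Scope ring_scope.

(* The ideals of MathComp's ring_quotient are decidable and proper; here an
   ideal is an arbitrary subset, and the unit ideal is one. *)
Definition is_ideal (R : comPzRingType) (I : set R) : Prop :=
  [/\ I 0, forall x y, I x -> I y -> I (x + y) & forall a x, I x -> I (a * x)].

Definition ideal_span (R : comPzRingType) (A : set R) : set R :=
  smallest (@is_ideal R) A.

Definition idealM (R : comPzRingType) (I J : set R) : set R :=
  ideal_span [set x * y | x in I & y in J].

Fixpoint idealX (R : comPzRingType) (I : set R) (n : nat) : set R :=
  if n is m.+1 then idealM I (idealX I m) else setT.

Definition finitely_generated (R : comPzRingType) (I : set R) : Prop :=
  exists s : seq R, I = ideal_span [set` s].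

Definition Spec (R : comPzRingType) : set (set R) :=
  [set P | [/\ is_ideal P, ~ P 1 & forall x y, P (x * y) -> P x \/ P y]].

Definition Max (R : comPzRingType) : set (set R) :=
  [set M | [/\ is_ideal M, ~ M 1 &
    forall J, is_ideal J -> ~ J 1 -> M `<=` J -> J = M]].

Definition Min (R : comPzRingType) : set (set R) :=
  [set P | Spec P /\ forall Q, Spec Q -> Q `<=` P -> Q = P].

Lemma Max_sub_Spec (R : comPzRingType) : @Max R `<=` @Spec R.
Proof.
move=> M [[M0 MD MM] M1 Mmax]; split=> // x y Mxy.
case: (EM (M x)) => [|nMx]; [by left | right].
pose J := [set z | exists a m, M m /\ z = a * x + m].
have MJ : M `<=` J by move=> m Mm; exists 0, m; rewrite mul0r add0r.
have JI : is_ideal J.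
  split; first exact: MJ.
    move=> _ _ [a [m [Mm ->]]] [b [k [Mk ->]]].
    by exists (a + b), (m + k); split; [exact: MD | rewrite mulrDl addrACA].
  move=> c _ [a [m [Mm ->]]].
  by exists (c * a), (c * m); split; [exact: MM | rewrite mulrDr mulrA].
have Jx : J x by exists 1, 0; rewrite mul1r addr0.
case: (EM (J 1)) => [[a [m [Mm e1]]]|J1]; last first.
  by case: nMx; rewrite -(Mmax J JI J1 MJ).
have -> : y = a * (x * y) + y * m.
  by rewrite -[LHS]mul1r e1 mulrDl mulrA [m * y]mulrC.
by apply: MD; apply: MM.
Qed.

Module Localization.
Section Localization.

Variables (R : comPzRingType) (P : set R) (hP : Spec P).

(* Pairs (numerator, denominator); the denominator lies outside P. *)
Definition prefrac := {x : R * R | x.2 \notin P}.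

Implicit Types x y z : prefrac.

Lemma den1 : (1 : R) \notin P.
Proof. by case: hP => _ P1 _; apply/negP => /set_mem. Qed.

Lemma denM (s t : R) : s \notin P -> t \notin P -> s * t \notin P.
Proof.
case: hP => _ _ PM /negP sP /negP tP; apply/negP => /set_mem /PM[] h.
  by apply: sP; exact: mem_set.
by apply: tP; exact: mem_set.
Qed.

Definition mkfrac (a s : R) (hs : s \notin P) : prefrac :=
  exist (fun x : R * R => x.2 \notin P) (a, s) hs.

Definition eqfrac x y : bool :=
  `[< exists2 t, t \notin P &
      t * ((val x).1 * (val y).2) = t * ((val y).1 * (val x).2) >].

Lemma eqfrac_refl : reflexive eqfrac.
Proof. by move=> x; apply/asboolP; exists 1; rewrite ?den1. Qed.

Lemma eqfrac_sym : symmetric eqfrac.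
Proof.
by move=> x y; apply/idP/idP => /asboolP[t tP e]; apply/asboolP; exists t.
Qed.

Lemma eqfrac_trans : transitive eqfrac.
Proof.
move=> [[b t] /= Pt] [[a s] /= Ps] [[c u] /= Pu].
move=> /asboolP[v Pv /= e1] /asboolP[w Pw /= e2].
apply/asboolP; exists (v * w * t); rewrite ?denM //=.
have -> : v * w * t * (a * u) = w * u * (v * (a * t)) by ring.
rewrite e1.
have -> : w * u * (v * (b * s)) = v * s * (w * (b * u)) by ring.
by rewrite e2; ring.
Qed.

Canonical eqfrac_equiv := EquivRel eqfrac eqfrac_refl eqfrac_sym eqfrac_trans.

Definition type := {eq_quot eqfrac}.
HB.instance Definition _ : EqQuotient _ eqfrac type := EqQuotient.on type.
HB.instance Definition _ := Choice.on type.

Lemma pi_eqP x y :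
  reflect (exists2 t, t \notin P &
      t * ((val x).1 * (val y).2) = t * ((val y).1 * (val x).2))
    (\pi_type x == \pi_type y).
Proof. by rewrite eqmodE; apply: asboolP. Qed.

Lemma pi_repr x : exists2 t, t \notin P &
  t * ((val x).1 * (val (repr (\pi_type x))).2) =
  t * ((val (repr (\pi_type x))).1 * (val x).2).
Proof. by apply/pi_eqP; rewrite reprK. Qed.

Definition addf x y : prefrac :=
  mkfrac ((val x).1 * (val y).2 + (val y).1 * (val x).2)
    (denM (valP x) (valP y)).
Definition add := lift_op2 type addf.

Lemma pi_add : {morph \pi : x y / addf x y >-> add x y}.
Proof.
move=> x y; unlock add; apply/eqP/pi_eqP.
have [t tP ex] := pi_repr x; have [u uP ey] := pi_repr y.
exists (t * u); rewrite ?denM //=.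
move: ex ey => /=; set x' := repr (\pi x); set y' := repr (\pi y).
case: (sval x) (sval y) (sval x') (sval y') => [a s] [b r] [a' s'] [b' r'] /=.
move=> ex ey.
transitivity (t * (a * s') * (u * r * r') + u * (b * r') * (t * s * s')).
  by ring.
by rewrite ex ey; ring.
Qed.
Canonical pi_add_morph := PiMorph2 pi_add.

Definition oppf x : prefrac := mkfrac (- (val x).1) (valP x).
Definition opp := lift_op1 type oppf.

Lemma pi_opp : {morph \pi : x / oppf x >-> opp x}.
Proof.
move=> x; unlock opp; apply/eqP/pi_eqP.
have [t tP ex] := pi_repr x; exists t => //=.
by rewrite !mulNr !mulrN ex.
Qed.
Canonical pi_opp_morph := PiMorph1 pi_opp.

Definition mulf x y : prefrac :=
  mkfrac ((val x).1 * (val y).1) (denM (valP x) (valP y)).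
Definition mul := lift_op2 type mulf.

Lemma pi_mul : {morph \pi : x y / mulf x y >-> mul x y}.
Proof.
move=> x y; unlock mul; apply/eqP/pi_eqP.
have [t tP ex] := pi_repr x; have [u uP ey] := pi_repr y.
exists (t * u); rewrite ?denM //=.
move: ex ey => /=; set x' := repr (\pi x); set y' := repr (\pi y).
case: (sval x) (sval y) (sval x') (sval y') => [a s] [b r] [a' s'] [b' r'] /=.
move=> ex ey.
transitivity (t * (a * s') * (u * (b * r'))); first by ring.
by rewrite ex ey; ring.
Qed.
Canonical pi_mul_morph := PiMorph2 pi_mul.

Definition tolocf (a : R) : prefrac := mkfrac a den1.
Definition toloc := lift_embed type tolocf.
Canonical toloc_pi_morph := PiEmbed toloc.

Lemma addA : associative add.
Proof.
elim/quotW=> x; elim/quotW=> y; elim/quotW=> z; rewrite !piE.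
by apply/eqP/pi_eqP; exists 1; rewrite ?den1 //=; ring.
Qed.

Lemma addC : commutative add.
Proof.
elim/quotW=> x; elim/quotW=> y; rewrite !piE.
by apply/eqP/pi_eqP; exists 1; rewrite ?den1 //=; ring.
Qed.

Lemma add0_l : left_id (toloc 0) add.
Proof.
elim/quotW=> x; rewrite !piE.
by apply/eqP/pi_eqP; exists 1; rewrite ?den1 //=; ring.
Qed.

Lemma addN_l : left_inverse (toloc 0) opp add.
Proof.
elim/quotW=> x; rewrite !piE.
by apply/eqP/pi_eqP; exists 1; rewrite ?den1 //=; ring.
Qed.

HB.instance Definition _ := GRing.isZmodule.Build type addA addC add0_l addN_l.

Lemma mulA : associative mul.
Proof.
elim/quotW=> x; elim/quotW=> y; elim/quotW=> z; rewrite !piE.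
by apply/eqP/pi_eqP; exists 1; rewrite ?den1 //=; ring.
Qed.

Lemma mulC : commutative mul.
Proof.
elim/quotW=> x; elim/quotW=> y; rewrite !piE.
by apply/eqP/pi_eqP; exists 1; rewrite ?den1 //=; ring.
Qed.

Lemma mul1_l : left_id (toloc 1) mul.
Proof.
elim/quotW=> x; rewrite !piE.
by apply/eqP/pi_eqP; exists 1; rewrite ?den1 //=; ring.
Qed.

Lemma mul_addl : left_distributive mul add.
Proof.
elim/quotW=> x; elim/quotW=> y; elim/quotW=> z; rewrite !piE.
by apply/eqP/pi_eqP; exists 1; rewrite ?den1 //=; ring.
Qed.

HB.instance Definition _ :=
  GRing.Zmodule_isComPzRing.Build type mulA mulC mul1_l mul_addl.

End Localization.
End Localization.
HB.export Localization.

Notation localization := Localization.type.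

Definition chain_ring (R : comPzRingType) : Prop :=
  forall I J : set R, is_ideal I -> is_ideal J -> I `<=` J \/ J `<=` I.

Definition arithmetical (R : comPzRingType) : Prop :=
  forall (M : set R) (hM : Max M), chain_ring (localization (Max_sub_Spec hM)).

(* Main.v *)
Require Import Defs.
From mathcomp Require Import all_boot all_algebra ring.
From mathcomp Require Import boolp classical_sets.

(** Localizing at a maximal ideal [M], arithmeticity says that of any two
    elements one divides the other up to a factor outside [M]; hence a finitely
    generated ideal is principal at [M].

    A nonminimal prime [P] with [P^n] finitely generated is maximal: if [P] is
    properly contained in [M] and [m] lies in [M] but not in [P], then [P = mP]
    at [M], so [P^n = m P^n] at [M], and Nakayama's lemma for the locally
    principal [P^n] gives [P^n = 0] at [M]. Then [P] is contained in every prime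
    inside [P], that is, [P] is minimal.

    If [P] is maximal, then either [P] is principal at [P], or [P = P^2] at [P]
    and again [P = P^n] is principal at [P]. If [x] generates [P] at [P], then
    [P = P^n + Rx], since both sides agree at [P] and are the unit ideal at
    the other maximal ideals. *)

Local Open Scope classical_set_scope.

Section Ideals.

Set Implicit Arguments.
Unset Strict Implicit.

Import GRing.Theory.
Local Open Scope ring_scope.

Variable R : comPzRingType.
Implicit Types (I M P : set R) (x y z : R).

(** * Ideals, their powers, and maximal ideals *)

Lemma ideal_span_is_ideal (A : set R) : is_ideal (ideal_span A).
Proof.
split=> [J [[] //]|x y Ax Ay J JA|a x Ax J JA].
  by case: (JA) => -[_ JD _] _; apply: JD; [exact: Ax | exact: Ay].
by case: (JA) => -[_ _ JM] _; apply: JM; exact: Ax.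
Qed.

Lemma mem_ideal_span (A : set R) x : A x -> ideal_span A x.
Proof. exact: sub_gen_smallest. Qed.

Lemma ideal_span_sub (A I : set R) : is_ideal I -> A `<=` I ->
  ideal_span A `<=` I.
Proof. exact: smallest_sub. Qed.

Lemma principal_is_ideal (S : comPzRingType) (x : S) :
  is_ideal [set z | exists c, z = c * x].
Proof.
split=> [|_ _ [c ->] [d ->]|a _ [c ->]]; first by exists 0; rewrite mul0r.
  by exists (c + d); rewrite mulrDl.
by exists (a * c); rewrite mulrA.
Qed.

Lemma idealX_is_ideal I n : is_ideal (idealX I n).
Proof. by case: n => [|n] //=; exact: ideal_span_is_ideal. Qed.

Lemma idealX_mulr I n x y : I x -> idealX I n y -> idealX I n.+1 (x * y).
Proof. by move=> Ix Iy; apply: mem_ideal_span; exists x => //; exists y. Qed.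

Lemma idealX_expr I n x : I x -> idealX I n (x ^+ n).
Proof.
by move=> Ix; elim: n => [|n IHn] //; rewrite exprS; exact: idealX_mulr.
Qed.

Lemma idealX_sub I n : is_ideal I -> (0 < n)%N -> idealX I n `<=` I.
Proof.
move=> II; case: n => // n _; apply: ideal_span_sub => // _ [x Ix [y _ <-]].
by rewrite mulrC; case: II => _ _; apply.
Qed.

Lemma exists_Max I : is_ideal I -> ~ I 1 -> exists2 M, Max M & I `<=` M.
Proof.
move=> II I1; case: (II) => I0 ID IM.
(* Zorn_bigcup also covers the empty chain, whose union must be admissible:
   hence the union with I. *)
pose proper A := is_ideal (A `|` I) /\ ~ (A `|` I) 1.
have [F Fp Ftot|A [[AI A1] Amax]] := @Zorn_bigcup R proper.
  split; last by case=> // -[X FX X1]; case: (Fp X FX) => _; apply; left.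
  split; first by right.
    move=> x y hx hy.
    (* Totality of the chain puts both elements in one member; the case where both lie in [I] covers
       the empty chain. *)
    have [[Ix Iy]|[X FX [Xx Xy]]] :
        I x /\ I y \/ exists2 X, F X & (X `|` I) x /\ (X `|` I) y.
      case: hx hy => [[X FX Xx]|Ix] [[Y FY Yy]|Iy].
      - right; have [XY|YX] := Ftot _ _ FX FY.
          by exists Y => //; split; left => //; exact: XY.
        by exists X => //; split; left => //; exact: YX.
      - by right; exists X => //; split; [left | right].
      - by right; exists Y => //; split; [right | left].
      - by left.
      by right; exact: ID.
    case: (Fp X FX) => -[_ XD _] _.
    by case: (XD x y Xx Xy) => h; [left; exists X | right].
  move=> a x [[X FX Xx]|Ix]; last by right; exact: IM.
  case: (Fp X FX) => -[_ _ XM] _.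
  by case: (XM a x (or_introl Xx)) => h; [left; exists X | right].
exists (A `|` I); last by move=> x; right.
split=> // J JI J1 sJ; apply/seteqP; split=> //.
apply: contrapT => nJ; apply: (Amax J).
  split; first by move=> x Ax; apply: sJ; left.
  by move=> sJA; apply: nJ => x /sJA; left.
by rewrite /proper (setUidl (subset_trans (@subsetUr _ A I) sJ)).
Qed.

(** * Divisibility up to a factor outside a prime *)

(** The principal ideals of the images of [x] and [y] are comparable in the localization at [M];
    clearing denominators gives [s]. *)
Lemma arithmetical_dvd M x y : arithmetical R -> Max M ->
  exists2 s, ~ M s & (exists a, s * x = a * y) \/ (exists a, s * y = a * x).
Proof.
move=> hR hM; pose loc := Localization.toloc (Max_sub_Spec hM).
have dvd_loc u v : (exists c, loc u = c * loc v) ->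
    exists2 s, ~ M s & exists a, s * u = a * v.
  case; elim/quotW => -[[a s] sM].
  rewrite -[_ * _]/(Localization.mul _ (loc v)) /loc !piE =>
    /eqP/Localization.pi_eqP[t tM /=].
  rewrite !mulr1 => e.
  (* Here [s] is the denominator of the quotient and [t] witnesses the equality of fractions. *)
  exists (t * s); last by exists (t * a); rewrite -!mulrA -e; ring.
  by move/mem_set; apply/negP; exact: (Localization.denM (Max_sub_Spec hM)).
have [xy|yx] := hR M hM _ _ (principal_is_ideal (loc x))
  (principal_is_ideal (loc y)).
  have [|s sM [a e]] := dvd_loc x y; last by exists s => //; left; exists a.
  by apply: xy; exists 1; rewrite mul1r.
have [|s sM [a e]] := dvd_loc y x; last by exists s => //; right; exists a.
by apply: yx; exists 1; rewrite mul1r.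
Qed.

Lemma Spec_mulN P s t : Spec P -> ~ P s -> ~ P t -> ~ P (s * t).
Proof. by case=> _ _ PM Ps Pt /PM[]. Qed.

(** This is the preimage in [R] of the localization of [aI]; since it is an ideal, containment of a
    span in it can be checked on generators. *)
Lemma dvd_outside_is_ideal M a (I : set R) : Spec M -> is_ideal I ->
  is_ideal [set z | exists2 s, ~ M s & exists2 w, I w & s * z = a * w].
Proof.
move=> hM [I0 ID IM]; split.
- by case: hM => _ M1 _; exists 1 => //; exists 0 => //; ring.
- move=> x y [s sM [w Iw e]] [t tM [v Iv f]].
  exists (s * t); first exact: Spec_mulN.
  exists (t * w + s * v); first by apply: ID; exact: IM.
  have -> : s * t * (x + y) = t * (s * x) + s * (t * y) by ring.
  by rewrite e f; ring.
- move=> b x [s sM [w Iw e]]; exists s => //; exists (b * w); first exact: IM.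
  by rewrite mulrCA e; ring.
Qed.

(** Induction on the generators: of the new one and the current [a], keep the one dividing the other
    at [M]. The denominators multiply to a common [t]. *)
Lemma fg_locally_principal M I : arithmetical R -> Max M -> is_ideal I ->
  finitely_generated I ->
  exists2 a, I a &
  exists2 t, ~ M t & forall z, I z -> exists c, t * z = a * c.
Proof.
move=> hR hM II [s eI]; have hS := Max_sub_Spec hM.
have sI : [set` s] `<=` I by rewrite eI => z; exact: mem_ideal_span.
have [a Ia [t tM ta]] : exists2 a, I a &
    exists2 t, ~ M t & forall z, z \in s -> exists c, t * z = a * c.
  elim: s sI {eI} => [|x s IHs] sI.
    by case: II hS => I0 _ _ [_ M1 _]; exists 0 => //; exists 1.
  have [|a Ia [t tM ta]] := IHs.
    by move=> z /= zs; apply: sI; rewrite /= inE zs orbT.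
  have [u uM [[b e]|[b e]]] := arithmetical_dvd x a hR hM.
    exists a => //; exists (t * u); first exact: Spec_mulN.
    move=> z; rewrite inE => /predU1P[->|/ta[c f]].
      by exists (t * b); rewrite -mulrA e; ring.
    by exists (u * c); rewrite mulrAC f; ring.
  exists x; first by apply: sI; rewrite /= mem_head.
  exists (t * u); first exact: Spec_mulN.
  move=> z; rewrite inE => /predU1P[->|/ta[c f]]; first by exists (t * u); ring.
  exists (b * c); have -> : t * u * z = u * (t * z) by ring.
  by rewrite f mulrA e; ring.
exists a => //; exists t => // z; rewrite eI.
have spanI : is_ideal [set z | exists c, t * z = a * c].
  split; first by exists 0; rewrite !mulr0.
    by move=> x y [c e] [d f]; exists (c + d); rewrite !mulrDr e f.
  by move=> b x [c e]; exists (b * c); rewrite mulrCA e mulrCA.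
exact: (ideal_span_sub spanI).
Qed.

(** * Nonminimal primes *)

Lemma Spec_fg_power_Max P n : arithmetical R -> Spec P -> ~ Min P ->
  (0 < n)%N -> finitely_generated (idealX P n) -> Max P.
Proof.
move=> hR hP Pmin n0 hfg; have [PI P1 PM] := hP.
have [M hM PsM] := exists_Max PI P1; have hS := Max_sub_Spec hM.
have [MI _ _] := hS.
suff /seteqP -> : P `<=` M /\ M `<=` P by [].
split=> // m Mm; apply: contrapT => Pm; apply: Pmin; split=> // Q hQ QP.
apply/seteqP; split=> // p Pp.
have P_mP x : P x -> exists2 s, ~ M s & exists2 w, P w & s * x = m * w.
  move=> Px; have [s sM [[a e]|[a e]]] := arithmetical_dvd x m hR hM.
    exists s => //; exists a; last by rewrite e mulrC.
    have : P (a * m) by rewrite -e; case: PI => _ _; exact.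
    by case/PM.
  (* This case would put [s] or [m] in [P], but [s] is outside [M] and [m] is outside [P]. *)
  have : P (s * m) by rewrite e; case: PI => _ _; exact.
  by case/PM => // /PsM.
have Pn_mPn x : idealX P n x ->
    exists2 s, ~ M s & exists2 w, idealX P n w & s * x = m * w.
  case: n n0 {hfg} => // n _.
  apply: (ideal_span_sub
    (dvd_outside_is_ideal m hS (idealX_is_ideal P n.+1))).
  move=> _ [u Pu [v Pv <-]]; have [s sM [w Pw e]] := P_mP u Pu.
  exists s => //; exists (w * v); first exact: idealX_mulr.
  by rewrite !mulrA e.
have [a Pa [t tM ta]] := fg_locally_principal hR hM (idealX_is_ideal P n) hfg.
have [s sM [w Pw e]] := Pn_mPn a Pa; have [c f] := ta w Pw.
(* Nakayama for one generator: [s * t - m * c] is invertible at [M], as [m] lies in [M], and it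
   annihilates [a]. *)
have uM : ~ M (s * t - m * c).
  move=> h; apply: (Spec_mulN hS sM tM).
  have -> : s * t = (s * t - m * c) + c * m by ring.
  by case: MI => _ MD MM; apply: MD => //; exact: MM.
have ua : (s * t - m * c) * a = 0.
  have -> : (s * t - m * c) * a = t * (s * a) - m * (a * c) by ring.
  by rewrite e -f; ring.
have [d g] := ta _ (idealX_expr n Pp).
(* The product is [0]. Its first two factors are outside [M], hence outside [Q], so primality of [Q]
   leaves [p]. *)
have Qp : Q ((s * t - m * c) * t * p ^+ n).
  rewrite -mulrA g mulrA ua mul0r; by case: hQ => -[].
have [QI Q1 QM] := hQ.
have QN x : ~ M x -> ~ Q x by move=> xM /QP/PsM.
case/QM: Qp => [/QM[/(QN _ uM)|/(QN _ tM)] //|].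
elim: n {n0 hfg Pn_mPn Pa ta Pw g e f ua uM} => [|k IHk];
  first by rewrite expr0.
by rewrite exprS => /QM[].
Qed.

(** * Maximal ideals *)

Lemma Max_locally_principal P n : arithmetical R -> Max P -> (0 < n)%N ->
  finitely_generated (idealX P n) ->
  exists2 x, P x &
  forall p, P p -> exists2 s, ~ P s & exists c, s * p = x * c.
Proof.
move=> hR hM n0 hfg; have hP := Max_sub_Spec hM; have [PI P1 _] := hP.
apply: contrapT => Pnp.
have PP x : P x ->
    exists2 s, ~ P s & exists a p, [/\ P a, P p & s * x = a * p].
  (* As [x] does not generate [P] at [P], some [p] is no multiple of it there; so [x] is a multiple
     [a * p], with [a] in [P] since otherwise [a] would serve as a denominator for [p]. *)
  move=> Px; have [p Pp pN] : exists2 p, P p &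
      ~ exists2 s, ~ P s & exists c, s * p = x * c.
    apply: contrapT => h; apply: Pnp; exists x => // p Pp.
    by apply: contrapT => h'; apply: h; exists p.
  have [s sP [[a e]|[a e]]] := arithmetical_dvd x p hR hM; last first.
    by case: pN; exists s => //; exists a; rewrite e mulrC.
  exists s => //; exists a, p; split=> //.
  by apply: contrapT => aP; apply: pN; exists a => //; exists s;
    rewrite -e mulrC.
have PPk k x : P x -> exists2 s, ~ P s & idealX P k (s * x).
  elim: k x => [|k IHk] x Px; first by exists 1.
  have [s sP [a [p [Pa Pp e]]]] := PP x Px; have [t tP Pt] := IHk p Pp.
  exists (t * s); first exact: Spec_mulN.
  by rewrite -mulrA e mulrCA; exact: idealX_mulr.
have [a Pa [t tP ta]] := fg_locally_principal hR hM (idealX_is_ideal P n) hfg.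
apply: Pnp; exists a; first exact: (idealX_sub PI n0).
move=> p /(PPk n)[s sP /ta[c e]].
by exists (t * s); [exact: Spec_mulN | exists c; rewrite -e mulrA].
Qed.

Lemma Max_comaximal_expr M s k : Max M -> ~ M s ->
  exists c m, M m /\ 1 = c * s + m ^+ k.
Proof.
move=> hM sM; have [[M0 MD MM] _ Mmax] := hM.
have [c [m [Mm e]]] : exists c m, M m /\ 1 = c * s + m.
  apply: contrapT => h; pose J := [set z | exists c m, M m /\ z = c * s + m].
  (* [h] is exactly [~ J 1], so maximality forces [J = M], although [J] contains [s]. *)
  apply: sM; rewrite -(Mmax J _ h); first by exists 1, 0; rewrite mul1r addr0.
    split; first by exists 0, 0; rewrite mul0r addr0.
      move=> _ _ [c [m [Mm ->]]] [d [l [Ml ->]]].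
      by exists (c + d), (m + l); split; [exact: MD | ring].
    move=> a _ [c [m [Mm ->]]].
    by exists (a * c), (a * m); split; [exact: MM | ring].
  by move=> m Mm; exists 0, m; rewrite mul0r add0r.
(* The same [m] serves every exponent; only the coefficient of [s] changes. *)
suff [d f] : exists d, 1 = d * s + m ^+ k by exists d, m.
elim: k => [|k [d f]]; first by exists 0; rewrite expr0 mul0r add0r.
exists (c + m * d).
transitivity (c * s + m * (d * s + m ^+ k)); first by rewrite -f mulr1.
by rewrite exprS; ring.
Qed.

Lemma Max_fg_power P n : arithmetical R -> Max P -> (0 < n)%N ->
  finitely_generated (idealX P n) -> finitely_generated P.
Proof.
move=> hR hM n0 hfg; have [PI _ _] := hM.
have [x Px Pgen] := Max_locally_principal hR hM n0 hfg.
case: hfg => s es; exists (x :: s).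
have Xs : idealX P n `<=` ideal_span [set` x :: s].
  rewrite es; apply: ideal_span_sub; first exact: ideal_span_is_ideal.
  by move=> z zs; apply: mem_ideal_span; rewrite /= inE (zs : z \in s) orbT.
apply/seteqP; split; last first.
  apply: ideal_span_sub => // z; rewrite /= inE => /predU1P[->//|zs].
  by apply: (idealX_sub PI n0); rewrite es; exact: mem_ideal_span.
move=> p Pp; have [t tP [b e]] := Pgen p Pp.
(* Multiplying this identity by [p] splits [p] into a multiple of [x] and [p * m ^+ n.-1]; the
   exponent is [n.-1] because [p] is the remaining factor from [P]. *)
have [c [m [Pm f]]] := Max_comaximal_expr n.-1 hM tP.
have [_ JD JM] := ideal_span_is_ideal [set` x :: s].
have -> : p = c * b * x + p * m ^+ n.-1.
  rewrite -[LHS]mul1r f mulrDl -mulrA e; ring.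
apply: JD; first by apply: JM; apply: mem_ideal_span; rewrite /= mem_head.
by apply: Xs; rewrite -(prednK n0); apply: idealX_mulr => //;
  exact: idealX_expr.
Qed.

End Ideals.

Theorem theorem3p9 (R : comPzRingType) (hR : arithmetical R)
    (P : set R) (hP : (@Max R `|` (@Spec R `\` @Min R)) P)
    (n : nat) (hn : (0 < n)%N) (hfg : finitely_generated (idealX P n)) :
  finitely_generated P.
Proof.
apply: (Max_fg_power hR _ hn hfg).
by case: hP => [//|[PS Pmin]]; exact: Spec_fg_power_Max hfg.
Qed.
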